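(* Let $\mathcal{H}$ be a complex Hilbert space and let $T=\begin{bmatrix} T_{11} & T_{12}\\ T_{21} & T_{22}\end{bmatrix}\in\mathcal{B}(\mathcal{H}\oplus\mathcal{H})$, where $T_{jk}\in\mathcal{B}(\mathcal{H})$ for $j,k=1,2$. Then $$\frac14\left\| |T_{12}|^2+|T_{21}^*|^2\right\|\le \omega^2(T).$$
   Context: $\mathcal{B}(\mathcal{K})$ denotes the algebra of bounded linear operators on a complex Hilbert space $\mathcal{K}$, and $\|\cdot\|$ is the operator norm. The numerical radius of $T\in\mathcal{B}(\mathcal{K})$ is $\omega(T)=\sup_{\|x\|=1}|\langle Tx,x\rangle|$, and $\omega^2(T)=(\omega(T))^2$. For an operator $X$, $|X|=(X^*X)^{1/2}$. *)

(* Defs.v *)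
From HB Require Import structures.
From mathcomp Require Import all_boot all_order all_algebra.
From mathcomp Require Import complex.
From mathcomp Require Import boolp classical_sets reals topology normedtype.
From mathcomp Require Import sesquilinear ring.

Set Implicit Arguments.
Unset Strict Implicit.
Unset Printing Implicit Defensive.

Import Order.TTheory GRing.Theory Num.Theory.
Import numFieldNormedType.Exports.

Local Open Scope classical_set_scope.
Local Open Scope ring_scope.
Local Open Scope complex_scope.

(* The inner product is linear in its first argument and conjugate-linear in  *)
(* its second one, as prescribed by {dot _ for _}.                            *)
HB.mixin Record NormedModule_isHilbert (R : realType) H
    of CompleteNormedModule R[i] H := {
  inner : {dot H for (@Num.conj R[i])};
  inner_norm : forall x : H, inner x x = `|x| ^+ 2
}.

#[short(type="hilbertType")]
HB.structure Definition Hilbert (R : realType) :=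
  {H of CompleteNormedModule R[i] H & NormedModule_isHilbert R H}.

Section DirectSum.
Context {R : realType}.

(* The library norm on the product type is the max norm, hence an alias.      *)
Definition dsum (H1 H2 : hilbertType R) : Type := (H1 * H2)%type.

Variables H1 H2 : hilbertType R.

HB.instance Definition _ := GRing.Lmodule.copy (dsum H1 H2) (H1 * H2)%type.

Definition dsum_inner (u v : dsum H1 H2) : R[i] :=
  inner u.1 v.1 + inner u.2 v.2.

Lemma dsum_inner_linearl v : linear_for *%R (dsum_inner ^~ v).
Proof.
move=> a u w; rewrite /dsum_inner /= !linearDl !linearZl_LR /= mulrDr addrACA.
by [].
Qed.

Lemma dsum_inner_linearr u :
  linear_for ((@Num.conj R[i]) \; *%R) (dsum_inner u).
Proof.
move=> a v w; rewrite /dsum_inner /= !linearDr !linearZr_LR /= mulrDr addrACA.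
by [].
Qed.

HB.instance Definition _ := bilinear_isBilinear.Build R[i]
  (dsum H1 H2) (dsum H1 H2) R[i] *%R ((@Num.conj R[i]) \; *%R) dsum_inner
  (pair dsum_inner_linearl dsum_inner_linearr).

Lemma dsum_inner_herm u v :
  dsum_inner u v = (-1) ^+ false * (dsum_inner v u)^*%R.
Proof.
rewrite /dsum_inner rmorphD /= expr0 mul1r.
by congr (_ + _); rewrite [LHS]hermC /= expr0 mul1r.
Qed.

HB.instance Definition _ := isHermitianSesquilinear.Build R[i]
  (dsum H1 H2) false (@Num.conj R[i]) dsum_inner dsum_inner_herm.

Lemma dsum_innerE u : dsum_inner u u = `|u.1| ^+ 2 + `|u.2| ^+ 2.
Proof. by rewrite /dsum_inner !inner_norm. Qed.

Lemma dsum_inner_gt0 u : u != 0 -> 0 < dsum_inner u u.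
Proof.
move=> u0; rewrite dsum_innerE lt_def addr_ge0 ?exprn_ge0 // andbT.
apply: contra u0; rewrite paddr_eq0 ?exprn_ge0 // !sqrf_eq0 !normr_eq0.
by case: u => x y /= /andP[/eqP -> /eqP ->].
Qed.

HB.instance Definition _ := isDotProduct.Build R[i] (dsum H1 H2) dsum_inner
  dsum_inner_gt0.

Definition dsum_norm (u : dsum H1 H2) : R[i] := sqrtC (dsum_inner u u).

Lemma dsum_normK u : dsum_norm u ^+ 2 = dsum_inner u u.
Proof. by rewrite /dsum_norm sqrtCK. Qed.

Lemma dsum_norm_ge0 u : 0 <= dsum_norm u.
Proof. by rewrite sqrtC_ge0 dsum_innerE addr_ge0 ?exprn_ge0. Qed.

Lemma dsum_normD u v : dsum_norm (u + v) <= dsum_norm u + dsum_norm v.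
Proof.
have nn : forall x y : R[i], 0 <= x -> 0 <= y -> x ^+ 2 <= y ^+ 2 -> x <= y.
  by move=> x y x0 y0; rewrite ler_sqr ?nnegrE.
have u0 := dsum_norm_ge0 u; have v0 := dsum_norm_ge0 v.
apply: (nn); rewrite ?dsum_norm_ge0 ?addr_ge0 //.
rewrite sqrrD !dsum_normK !dsum_innerE /=.
set a := `|u.1|; set b := `|u.2|; set c := `|v.1|; set d := `|v.2|.
have [a0 b0 c0 d0] : [/\ 0 <= a, 0 <= b, 0 <= c & 0 <= d].
  by split; exact: normr_ge0.
have h : a * c + b * d <= dsum_norm u * dsum_norm v.
  apply: (nn); rewrite ?addr_ge0 ?mulr_ge0 //.
  rewrite exprMn !dsum_normK !dsum_innerE -/a -/b -/c -/d -subr_ge0.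
  have -> : (a ^+ 2 + b ^+ 2) * (c ^+ 2 + d ^+ 2) - (a * c + b * d) ^+ 2
    = (a * d - b * c) ^+ 2 by ring.
  by rewrite real_exprn_even_ge0 // rpredB // rpredM // ger0_real.
apply: (@le_trans _ _ ((a + c) ^+ 2 + (b + d) ^+ 2)).
  by apply: lerD; rewrite ler_sqr ?nnegrE ?addr_ge0 //; exact: ler_normD.
have -> : (a + c) ^+ 2 + (b + d) ^+ 2
  = a ^+ 2 + b ^+ 2 + (a * c + b * d) *+ 2 + (c ^+ 2 + d ^+ 2) by ring.
by rewrite lerD2r lerD2l lerMn2r.
Qed.

Lemma dsum_normZ (l : R[i]) u : dsum_norm (l *: u) = `|l| * dsum_norm u.
Proof.
rewrite /dsum_norm !dsum_innerE /= !normrZ !exprMn -mulrDr.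
by rewrite sqrtCM ?nnegrE ?addr_ge0 ?exprn_ge0 // sqrCK.
Qed.

Lemma dsum_norm0_eq0 u : dsum_norm u = 0 -> u = 0.
Proof.
move=> /eqP; rewrite sqrtC_eq0 => u0; apply/eqP; apply: contraTT u0 => u0.
by rewrite gt_eqF // dsum_inner_gt0.
Qed.

HB.instance Definition _ := Lmodule_isNormed.Build R[i] (dsum H1 H2)
  dsum_normD dsum_normZ dsum_norm0_eq0.

Lemma dsum_normE (u : dsum H1 H2) :
  `|u| = sqrtC (`|u.1| ^+ 2 + `|u.2| ^+ 2).
Proof. by rewrite -dsum_innerE. Qed.

Lemma dsum_norm_fst (u : dsum H1 H2) : `|u.1| <= `|u|.
Proof.
rewrite dsum_normE -[leLHS]sqrCK // ler_sqrtC ?nnegrE ?addr_ge0 ?exprn_ge0 //.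
by rewrite lerDl exprn_ge0.
Qed.

Lemma dsum_norm_snd (u : dsum H1 H2) : `|u.2| <= `|u|.
Proof.
rewrite dsum_normE -[leLHS]sqrCK // ler_sqrtC ?nnegrE ?addr_ge0 ?exprn_ge0 //.
by rewrite lerDr exprn_ge0.
Qed.

Lemma dsum_norm_le (u : dsum H1 H2) : `|u| <= `|u.1| + `|u.2|.
Proof.
rewrite dsum_normE -[leRHS]sqrCK ?addr_ge0 //.
rewrite ler_sqrtC ?nnegrE ?addr_ge0 ?exprn_ge0 ?addr_ge0 //.
by rewrite sqrrD addrAC lerDl mulrn_wge0 ?mulr_ge0.
Qed.

Lemma dsum_complete (F : set_system (dsum H1 H2)) :
  ProperFilter F -> cauchy F -> cvg F.
Proof.
move=> FF /cauchy_ballP Fc.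
pose p1 (u : dsum H1 H2) : H1 := u.1; pose p2 (u : dsum H1 H2) : H2 := u.2.
have c1 : cvg (p1 @ F).
  apply: cauchy_cvg; apply/cauchy_ballP => e e0; near_simpl.
  apply: filterS (Fc e e0) => -[u v] /=.
  rewrite -!ball_normE /=; apply: le_lt_trans.
  exact: (dsum_norm_fst (u - v)).
have c2 : cvg (p2 @ F).
  apply: cauchy_cvg; apply/cauchy_ballP => e e0; near_simpl.
  apply: filterS (Fc e e0) => -[u v] /=.
  rewrite -!ball_normE /=; apply: le_lt_trans.
  exact: (dsum_norm_snd (u - v)).
apply/cvg_ex; exists ((lim (p1 @ F), lim (p2 @ F)) : dsum H1 H2).
apply/cvgrPdist_lt => e e0.
have e20 : 0 < e / 2 by rewrite divr_gt0.
have n1 := (@cvgrPdist_lt _ _ _ _ _ p1 _).1 c1 _ e20.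
have n2 := (@cvgrPdist_lt _ _ _ _ _ p2 _).1 c2 _ e20.
near=> u.
apply: le_lt_trans (dsum_norm_le _) _; rewrite [ltRHS]splitr /=.
apply: ltrD.
  by near: u; exact: n1.
by near: u; exact: n2.
Unshelve. all: by end_near. Qed.

HB.instance Definition _ := Uniform_isComplete.Build (dsum H1 H2) dsum_complete.

Lemma dsum_inner_norm (u : dsum H1 H2) : dsum_inner u u = `|u| ^+ 2.
Proof. by rewrite -dsum_normK. Qed.

HB.instance Definition _ := NormedModule_isHilbert.Build R (dsum H1 H2)
  dsum_inner_norm.
End DirectSum.

Section BoundedOperators.
Context {R : realType}.

Record bop (K : hilbertType R) := Bop {
  bop_fun :> K -> K;
  bop_linear : linear bop_fun;
  bop_bounded : bounded_near bop_fun (nbhs (0 : K))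
}.

HB.instance Definition _ K (A : bop K) :=
  GRing.isLinear.Build R[i] K K *:%R (bop_fun A) (bop_linear A).

HB.instance Definition _ K := gen_eqMixin (bop K).
HB.instance Definition _ K := gen_choiceMixin (bop K).

Lemma bopP (K : hilbertType R) (A B : bop K) : A =1 B -> A = B.
Proof.
case: A B => [a la ba] [b lb bb] /= /funext eab; case: _ / eab lb bb => lb bb.
by rewrite (Prop_irrelevance la lb) (Prop_irrelevance ba bb).
Qed.

Lemma bop_normP (K : hilbertType R) (f : {linear K -> K}) :
  (exists M : R[i], forall x, `|f x| <= M * `|x|) ->
  bounded_near f (nbhs (0 : K)).
Proof.
move=> [M fM]; apply/linear_boundedP; exists `|M|; split.
  by rewrite ger0_real.
move=> r /ltW Mr x; apply: le_trans (fM x) _.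
case: (eqVneq x 0) => [->|x0]; first by rewrite normr0 !mulr0.
have Mx : 0 <= M * `|x| by apply: le_trans (fM x).
have M0 : 0 <= M by rewrite -(pmulr_lge0 (x := `|x|)) ?normr_gt0.
by rewrite ler_wpM2r //; rewrite ger0_norm in Mr.
Qed.

Lemma bop_norm_ex (K : hilbertType R) (A : bop K) :
  exists2 M : R[i], 0 <= M & forall x, `|A x| <= M * `|x|.
Proof.
have /linear_boundedP/pinfty_ex_gt0[M M0 AM] := bop_bounded A.
by exists M; first exact: ltW.
Qed.

Variable K : hilbertType R.
Implicit Types A B : bop K.

Fact bop0_bounded : bounded_near (\0 : K -> K) (nbhs (0 : K)).
Proof. by apply: bop_normP; exists 0 => x; rewrite normr0 mul0r. Qed.

Definition bop0 := @Bop K \0 (@linearP _ _ _ _ (\0)) bop0_bounded.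

Fact bop1_bounded : bounded_near (idfun : K -> K) (nbhs (0 : K)).
Proof. by apply: bop_normP; exists 1 => x; rewrite mul1r. Qed.

Definition bop1 := @Bop K idfun (@linearP _ _ _ _ idfun) bop1_bounded.

Fact bop_opp_bounded A : bounded_near (\- A) (nbhs (0 : K)).
Proof.
have [M M0 AM] := bop_norm_ex A; apply: bop_normP; exists M => x.
by rewrite /= normrN.
Qed.

Definition bop_opp A := @Bop K (\- A) (@linearP _ _ _ _ (\- A))
  (bop_opp_bounded A).

Fact bop_add_bounded A B : bounded_near (A \+ B) (nbhs (0 : K)).
Proof.
have [M M0 AM] := bop_norm_ex A; have [N N0 BN] := bop_norm_ex B.
apply: bop_normP; exists (M + N) => x /=.
by rewrite mulrDl (le_trans (ler_normD _ _)) // lerD.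
Qed.

Definition bop_add A B := @Bop K (A \+ B) (@linearP _ _ _ _ (A \+ B))
  (bop_add_bounded A B).

Fact bop_comp_bounded A B : bounded_near (A \o B) (nbhs (0 : K)).
Proof.
have [M M0 AM] := bop_norm_ex A; have [N N0 BN] := bop_norm_ex B.
apply: bop_normP; exists (M * N) => x /=.
by rewrite (le_trans (AM _)) // -mulrA ler_wpM2l.
Qed.

Definition bop_comp A B := @Bop K (A \o B) (@linearP _ _ _ _ (A \o B))
  (bop_comp_bounded A B).

Fact bop_addA : associative bop_add.
Proof. by move=> A B C; apply: bopP => x /=; rewrite addrA. Qed.
Fact bop_addC : commutative bop_add.
Proof. by move=> A B; apply: bopP => x /=; rewrite addrC. Qed.
Fact bop_add0 : left_id bop0 bop_add.
Proof. by move=> A; apply: bopP => x /=; rewrite add0r. Qed.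
Fact bop_addN : left_inverse bop0 bop_opp bop_add.
Proof. by move=> A; apply: bopP => x /=; rewrite addNr. Qed.

HB.instance Definition _ := GRing.isZmodule.Build (bop K)
  bop_addA bop_addC bop_add0 bop_addN.

Fact bop_compA : associative bop_comp.
Proof. by move=> A B C; apply: bopP. Qed.
Fact bop_comp1l : left_id bop1 bop_comp.
Proof. by move=> A; apply: bopP. Qed.
Fact bop_comp1r : right_id bop1 bop_comp.
Proof. by move=> A; apply: bopP. Qed.
Fact bop_compDl : left_distributive bop_comp bop_add.
Proof. by move=> A B C; apply: bopP. Qed.
Fact bop_compDr : right_distributive bop_comp bop_add.
Proof. by move=> A B C; apply: bopP => x /=; rewrite linearD. Qed.

HB.instance Definition _ := GRing.Zmodule_isPzRing.Build (bop K)
  bop_compA bop_comp1l bop_comp1r bop_compDl bop_compDr.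

(* Order and norms of R[i] are complex-valued; Re reads off the real value.   *)
Definition opnorm A : R :=
  sup [set complex.Re `|A x| | x in [set x : K | `|x| <= 1]].

Definition numradius A : R :=
  sup [set complex.Re `|inner (A x) x| | x in [set x : K | `|x| = 1]].

(* Both the adjoint of an operator and the positive square root of a positive *)
(* operator exist and are unique, so that xget never returns its default 0    *)
(* here; possqrt is meaningful for positive operators only.                   *)
Definition adjoint A : bop K :=
  xget 0 [set B : bop K | forall x y, inner (A x) y = inner x (B y)].

Definition positive A : Prop := forall x, 0 <= inner (A x) x.

Definition possqrt A : bop K :=
  xget 0 [set S : bop K | positive S /\ S ^+ 2 = A].

Definition absop A : bop K := possqrt (adjoint A * A).

End BoundedOperators.

Section BlockOperator.
Context {R : realType} {H : hilbertType R}.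
Variables T11 T12 T21 T22 : bop H.

Definition blockop_fun (u : dsum H H) : dsum H H :=
  (T11 u.1 + T12 u.2, T21 u.1 + T22 u.2).

Fact blockop_linear : linear blockop_fun.
Proof.
move=> a u v; rewrite /blockop_fun /= !linearP.
by congr (_, _); rewrite /= scalerDr addrACA.
Qed.

HB.instance Definition _ := GRing.isLinear.Build R[i] (dsum H H) (dsum H H)
  *:%R blockop_fun blockop_linear.

Fact blockop_bounded : bounded_near blockop_fun (nbhs (0 : dsum H H)).
Proof.
have [M11 ? h11] := bop_norm_ex T11; have [M12 ? h12] := bop_norm_ex T12.
have [M21 ? h21] := bop_norm_ex T21; have [M22 ? h22] := bop_norm_ex T22.
apply: bop_normP; exists (M11 + M12 + (M21 + M22)) => u.
apply: le_trans (dsum_norm_le _) _; rewrite mulrDl.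
have u1 := dsum_norm_fst u; have u2 := dsum_norm_snd u.
apply: lerD; rewrite mulrDl (le_trans (ler_normD _ _)) // lerD //.
- by rewrite (le_trans (h11 _)) // ler_wpM2l.
- by rewrite (le_trans (h12 _)) // ler_wpM2l.
- by rewrite (le_trans (h21 _)) // ler_wpM2l.
- by rewrite (le_trans (h22 _)) // ler_wpM2l.
Qed.

Definition blockop : bop (dsum H H) := Bop blockop_linear blockop_bounded.

End BlockOperator.

(* Main.v *)
Require Import Defs.
From mathcomp Require Import all_boot all_order all_algebra.
From mathcomp Require Import complex boolp classical_sets sesquilinear.
From mathcomp Require Import topology normedtype ring lra.
From mathcomp Require Import reals.

Import Order.TTheory GRing.Theory Num.Theory.
Local Open Scope ring_scope.
Local Open Scope complex_scope.

(** Let w be the numerical radius of T, and write N x for the squared norm of x.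

    Comparing the quadratic form of T at (x, y) and at (x, - y) cancels the
    diagonal blocks, so that |<T12 y, x> + <T21 x, y>| <= w (N x + N y)
    ([offdiag_le]).  The phase of y and the phase of the whole expression may
    be chosen independently, which makes both Re <(T12 + T21^* ) y, x> and
    Re <(T12 - T21^* ) y, x> at most w (N x + N y).

    A bound Re <z, x> <= c (N x + s) valid for all x is a bound on z: testing
    it on the best real multiple of z gives N z <= 4 c^2 s
    ([sqnorm_le_form]).  Hence (T12 + T21^* ) y and (T12 - T21^* ) y both have
    squared norm at most 4 w^2 N y, and the parallelogram identity yields
    N (T12 y) + N (T21^* y) <= 4 w^2 N y ([offdiag_sqnorm_le]).

    The left-hand side is the quadratic form of the positive operator
    S = |T12|^2 + |T21^*|^2, so this already says <S y, y> <= 4 w^2 N y.  To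
    pass to the norm of S, the arithmetic-geometric inequality
    Re <A x, A y> <= (N (A x) + N (A y)) / 2 turns it into
    Re <S x, y> <= 2 w^2 (N x + N y), and [sqnorm_le_form] applies again, now
    with c = 2 w^2, to give N (S x) <= (4 w^2)^2 N x. *)

(** * The real inner product *)

(** The order of [R[i]] is partial; all estimates are therefore carried out on
    the real part of the inner product, a symmetric real bilinear form with
    the same norm and values in the totally ordered field [R]. *)
Definition rdot {R : realType} {K : hilbertType R} (x y : K) : R :=
  complex.Re (inner x y).

Lemma Re_add (R : realType) (a b : R[i]) :
  complex.Re (a + b) = complex.Re a + complex.Re b.
Proof. by case: a => ? ?; case: b. Qed.

Lemma Re_opp (R : realType) (a : R[i]) : complex.Re (- a) = - complex.Re a.
Proof. by case: a. Qed.

Lemma Re_scale (R : realType) (t : R) (a : R[i]) :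
  complex.Re (t%:C * a) = t * complex.Re a.
Proof. by case: a => ? ? /=; rewrite mul0r subr0. Qed.

Lemma Re_conj (R : realType) (a : R[i]) :
  complex.Re (Num.conj a) = complex.Re a.
Proof. by case: a. Qed.

Lemma Re_le_norm (R : realType) (a : R[i]) :
  complex.Re a <= complex.Re `|a|.
Proof.
by have := normc_ge_Re a; rewrite lecE => /andP[_ /=]; apply/le_trans/ler_norm.
Qed.

Lemma ex_phase (R : realType) (a : R[i]) :
  exists2 c : R[i], `|c| = 1 & c * a = `|a|.
Proof.
have [->|a0] := eqVneq a 0; first by exists 1; rewrite ?normr1 // mulr0 normr0.
exists (`|a| / a); last by rewrite mulfVK.
by rewrite normf_div normr_id divff // normr_eq0.
Qed.

Section RealInnerProduct.
Context {R : realType} {K : hilbertType R}.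
Implicit Types (x y z : K) (t : R).

Lemma Re_norm_ge0 x : 0 <= complex.Re `|x|.
Proof. by have := normr_ge0 x; rewrite lecE => /andP[]. Qed.

Lemma Re_normE x : (complex.Re `|x|)%:C = `|x|.
Proof. by apply: RRe_real; exact: normr_real. Qed.

Lemma rdotC x y : rdot x y = rdot y x.
Proof. by rewrite /rdot hermC /= expr0 mul1r Re_conj. Qed.

Lemma rdotDl x y z : rdot (x + y) z = rdot x z + rdot y z.
Proof. by rewrite /rdot linearDl Re_add. Qed.

Lemma rdotDr x y z : rdot x (y + z) = rdot x y + rdot x z.
Proof. by rewrite !(rdotC x) rdotDl. Qed.

Lemma rdotNl x y : rdot (- x) y = - rdot x y.
Proof. by rewrite /rdot linearNl Re_opp. Qed.

Lemma rdotNr x y : rdot x (- y) = - rdot x y.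
Proof. by rewrite !(rdotC x) rdotNl. Qed.

Lemma rdotZl t x y : rdot (t%:C *: x) y = t * rdot x y.
Proof. by rewrite /rdot linearZl_LR Re_scale. Qed.

Lemma rdotZr t x y : rdot x (t%:C *: y) = t * rdot x y.
Proof. by rewrite !(rdotC x) rdotZl. Qed.

Lemma rdot0l x : rdot 0 x = 0.
Proof. by rewrite /rdot linear0l. Qed.

Lemma rdotZZ (c : R[i]) x y :
  rdot (c *: x) (c *: y) = complex.Re `|c| ^+ 2 * rdot x y.
Proof.
rewrite /rdot linearZl_LR linearZr_LR mulrA -normCK normc_def.
by rewrite -rmorphXn Re_scale.
Qed.

Lemma normci : `|'i%C : R[i]| = 1.
Proof. by rewrite normc_def /= expr0n expr1n add0r sqrtr1. Qed.

Lemma rdotii x y : rdot ('i%C *: x) (- 'i%C *: y) = - rdot x y.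
Proof. by rewrite scaleNr rdotNr rdotZZ normci /= expr1n mul1r. Qed.

Lemma rdotxx x : rdot x x = complex.Re `|x| ^+ 2.
Proof. by rewrite /rdot inner_norm -Re_normE -rmorphXn. Qed.

Lemma rdot_ge0 x : 0 <= rdot x x.
Proof. by rewrite rdotxx sqr_ge0. Qed.

(** This arithmetic-geometric form of the Cauchy-Schwarz inequality is the
    expansion of [0 <= rdot (x - y) (x - y)]. *)
Lemma rdot_le x y : rdot x y <= (rdot x x + rdot y y) / 2.
Proof.
have := rdot_ge0 (x - y).
rewrite rdotDl !rdotDr !rdotNl !rdotNr (rdotC y x); lra.
Qed.

(** A vector is controlled by the linear form that it represents.  On the real
    multiple [t *: z] the hypothesis reads [t n <= c (t^2 n + s)] with
    [n := rdot z z]; the choice [t = 1 / (2 c)], which maximizes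
    [t - c t^2], leaves [n / (4 c) <= c s]. *)
Lemma sqnorm_le_form (c s : R) z : 0 <= c ->
  (forall x, rdot z x <= c * (rdot x x + s)) -> rdot z z <= 4 * c ^+ 2 * s.
Proof.
rewrite le_eqVlt => /orP[/eqP <- /(_ z)|c0 zle].
  by rewrite mul0r expr0n mulr0 mul0r.
have := zle ((2 * c)^-1%:C *: z); rewrite rdotZl !rdotZr.
set n := rdot z z => h.
have -> : n = 2 * c *
    (2 * ((2 * c)^-1 * n - c * ((2 * c)^-1 * ((2 * c)^-1 * n)))).
  by field; lra.
have -> : 4 * c ^+ 2 * s = 2 * c * (2 * (c * s)) by ring.
apply: ler_wpM2l; lra.
Qed.

End RealInnerProduct.

(** * Operator norm, numerical radius and absolute value *)

Section Operators.
Context {R : realType} {K : hilbertType R}.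
Implicit Types (A : bop K) (x y : K).

Lemma opnorm_le A (c : R) : 0 <= c ->
  (forall x, rdot (A x) (A x) <= c ^+ 2 * rdot x x) -> opnorm A <= c.
Proof.
move=> c0 Ac; apply: ge_sup.
  by exists (complex.Re `|A 0|); exists 0 => //=; rewrite normr0.
move=> _ [x x1 <-].
have {}x1 : complex.Re `|x| <= 1.
  by move: (x1 : `|x| <= 1); rewrite lecE => /andP[].
rewrite -(@ler_pXn2r _ 2) ?nnegrE ?Re_norm_ge0 // -rdotxx.
apply: le_trans (Ac x) _; rewrite rdotxx.
by rewrite ler_piMr ?sqr_ge0 // exprn_ile1 // Re_norm_ge0.
Qed.

Lemma numradius_has_ubound A :
  has_ubound [set complex.Re `|inner (A x) x| | x in [set x : K | `|x| = 1]].
Proof.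
have [M M0 AM] := bop_norm_ex A.
(* rdot_le against a phase of A x, with |A x| <= M and |x| = 1 *)
exists ((complex.Re M ^+ 2 + 1) / 2) => _ [x x1 <-].
have {}x1 : `|x| = 1 := x1.
have [c c1 <-] := ex_phase _ (inner (A x) x).
rewrite -linearZl_LR; apply: (le_trans (rdot_le _ _)).
rewrite rdotZZ c1 (rdotxx x) x1 /= !expr1n mul1r rdotxx.
rewrite ler_pM2r ?invr_gt0 // lerD2r ler_pXn2r ?nnegrE ?Re_norm_ge0 //.
  by have := AM x; rewrite x1 mulr1 lecE => /andP[].
by move: M0; rewrite lecE => /andP[].
Qed.

Lemma numradius_ge0 A : 0 <= numradius A.
Proof.
rewrite /numradius; set E : set R := (X in sup X).
(* on the zero space the set is empty and its supremum is 0 *)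
have [->|/set0P[r Er]] := eqVneq E set0; first by rewrite sup0.
have ub : r <= sup E.
  apply: sup_upper_bound (Er); split; first by exists r.
  exact: numradius_has_ubound.
apply: le_trans ub; case: Er => x _ <-.
by have := normr_ge0 (inner (A x) x); rewrite lecE => /andP[].
Qed.

(** The phase [c] encodes, inside a real statement, that the modulus of
    [inner (A x) x] is bounded and not only its real part. *)
Lemma numradius_form A (c : R[i]) x : `|c| = 1 ->
  rdot (c *: A x) x <= numradius A * rdot x x.
Proof.
move=> c1; have [->|x0] := eqVneq x 0.
  by rewrite linear0 scaler0 !rdot0l mulr0.
pose r := complex.Re `|x|; have r0 : 0 < r.
  rewrite lt_def Re_norm_ge0 andbT; apply: contra x0 => /eqP r0.
  by rewrite -normr_eq0 -Re_normE -/r r0.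
pose u := r^-1%:C *: x.
have xE : x = r%:C *: u.
  by rewrite scalerA -rmorphM divff ?gt_eqF // scale1r.
have u1 : `|u| = 1.
  by rewrite normrZ -Re_normE -/r normc_def /= expr0n addr0 sqrtr_sqr
    -rmorphM gtr0_norm ?invr_gt0 // mulVf ?gt_eqF.
rewrite rdotxx xE linearZ scalerA mulrC -scalerA rdotZl rdotZr mulrA.
rewrite -xE -/r -expr2 mulrC ler_wpM2r ?sqr_ge0 //.
apply: (@le_trans _ _ (complex.Re `|inner (A u) u|)).
  rewrite /rdot linearZl_LR; apply: le_trans (Re_le_norm _ _) _.
  by rewrite normrM c1 mul1r.
apply: sup_upper_bound; last by exists u.
split; first by exists (complex.Re `|inner (A u) u|); exists u.
exact: numradius_has_ubound.
Qed.

Lemma adjointP A :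
  (forall x y, inner (A x) y = inner x (adjoint A y)) \/ adjoint A = 0.
Proof. by rewrite /adjoint; case: xgetP => [B _ AB|_]; [left|right]. Qed.

(** From [absop A ^+ 2 = adjoint A * A] the left-hand side is
    [rdot (A x) (A y)], and [rdot_le] applies.  A default value 0 of the
    square root or of the adjoint makes the left-hand side vanish. *)
Lemma rdot_absop_sqr_le A x y :
  rdot ((absop A ^+ 2) x) y <= (rdot (A x) (A x) + rdot (A y) (A y)) / 2.
Proof.
have ge0 : 0 <= (rdot (A x) (A x) + rdot (A y) (A y)) / 2.
  by rewrite divr_ge0 // addr_ge0 // rdot_ge0.
rewrite /absop /possqrt; case: xgetP => [S _ [_ ->]|_]; last first.
  by rewrite expr2 mul0r rdot0l.
have [adj|->] := adjointP A; last by rewrite mul0r rdot0l.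
by rewrite rdotC /rdot -adj; apply: le_trans (rdot_le _ _) _; rewrite addrC.
Qed.

End Operators.

(** * The off-diagonal blocks *)

Section OffDiagonal.
Context {R : realType} {H : hilbertType R}.
Variables T11 T12 T21 T22 : bop H.
Implicit Types x y : H.

Let w := numradius (blockop T11 T12 T21 T22).

Lemma rdot_dsum (u v : dsum H H) : rdot u v = rdot u.1 v.1 + rdot u.2 v.2.
Proof. exact: Re_add. Qed.

(** Reversing the sign of the second component changes the sign of the
    off-diagonal part of the quadratic form only, so half the difference of
    the two values is the off-diagonal part. *)
Lemma offdiag_le (c : R[i]) x y : `|c| = 1 ->
  rdot (c *: T12 y) x + rdot (c *: T21 x) y <= w * (rdot x x + rdot y y).
Proof.
move=> c1; have cN1 : `|- c| = 1 by rewrite normrN.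
have := numradius_form (blockop T11 T12 T21 T22) c ((x, y) : dsum H H) c1.
have := numradius_form (blockop T11 T12 T21 T22) (- c)
  ((x, - y) : dsum H H) cN1.
rewrite -/w !rdot_dsum /= !scaleNr !linearN.
rewrite !scalerDr !scalerN !rdotNl !rdotNr !rdotDl !rdotNl.
lra.
Qed.

Lemma offdiag_add_le x y :
  rdot (T12 y) x + rdot (T21 x) y <= w * (rdot x x + rdot y y).
Proof. by have := offdiag_le 1 x y (normr1 _); rewrite !scale1r. Qed.

(** Replacing [y] by [- i y] and multiplying the form by [i] fixes the term
    linear in [y], since [i (- i) = 1], and negates the conjugate-linear one,
    since [i i = - 1]. *)
Lemma offdiag_sub_le x y :
  rdot (T12 y) x - rdot (T21 x) y <= w * (rdot x x + rdot y y).
Proof.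
have := offdiag_le 'i%C x (- 'i%C *: y) normci.
rewrite linearZ scalerA mulrN -expr2 sqr_i opprK scale1r rdotii.
by rewrite rdotZZ normrN normci /= expr1n mul1r.
Qed.

(** When the second operator is the adjoint of [T21], the two preceding bounds
    control [T12 x + adjoint T21 x] and [T12 x - adjoint T21 x], and the
    parallelogram identity concludes.  When it is 0, their half sum controls
    [T12 x] alone. *)
Lemma offdiag_sqnorm_le x :
  rdot (T12 x) (T12 x) + rdot (adjoint T21 x) (adjoint T21 x)
    <= 4 * w ^+ 2 * rdot x x.
Proof.
have w0 : 0 <= w := numradius_ge0 _.
have [adj|->] := adjointP T21; last first.
  rewrite rdot0l addr0; apply: sqnorm_le_form w0 _ => y.
  have := offdiag_add_le y x; have := offdiag_sub_le y x; lra.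
have adjE y : rdot (adjoint T21 x) y = rdot (T21 y) x.
  by rewrite rdotC /rdot adj.
have sum_le : rdot (T12 x + adjoint T21 x) (T12 x + adjoint T21 x)
    <= 4 * w ^+ 2 * rdot x x.
  apply: sqnorm_le_form w0 _ => y.
  by rewrite rdotDl adjE; exact: offdiag_add_le.
have diff_le : rdot (T12 x - adjoint T21 x) (T12 x - adjoint T21 x)
    <= 4 * w ^+ 2 * rdot x x.
  apply: sqnorm_le_form w0 _ => y.
  by rewrite rdotDl rdotNl adjE; exact: offdiag_sub_le.
move: sum_le diff_le.
rewrite !rdotDl !rdotDr !rdotNl !rdotNr (rdotC (T12 x) (adjoint T21 x)).
lra.
Qed.

End OffDiagonal.

Theorem theorem2p1 (R : realType) (H : hilbertType R)
    (T : bop (dsum H H)) (T11 T12 T21 T22 : bop H)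
    (hT : T = blockop T11 T12 T21 T22) :
  4^-1 * opnorm (absop T12 ^+ 2 + absop (adjoint T21) ^+ 2)
    <= numradius T ^+ 2.
Proof.
rewrite hT; set w := numradius _.
have w2 : 0 <= 2 * w ^+ 2 by rewrite mulr_ge0 ?sqr_ge0.
suff : opnorm (absop T12 ^+ 2 + absop (adjoint T21) ^+ 2) <= 4 * w ^+ 2 by lra.
apply: opnorm_le => [|x]; first by rewrite mulr_ge0 ?sqr_ge0.
(* the shape 4 * c ^+ 2 of sqnorm_le_form, with c = 2 * w ^+ 2 *)
have -> : (4 * w ^+ 2) ^+ 2 = 4 * (2 * w ^+ 2) ^+ 2 by ring.
apply: sqnorm_le_form => // y; rewrite rdotDl.
have := rdot_absop_sqr_le T12 x y.
have := rdot_absop_sqr_le (adjoint T21) x y.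
have := offdiag_sqnorm_le T11 T12 T21 T22 x.
have := offdiag_sqnorm_le T11 T12 T21 T22 y.
rewrite -/w; lra.
Qed.
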